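(* Fix integers $\Delta\geq \delta\geq 1$ and let $f$ be a real-valued function on pairs of positive integers with $f(x,y)=f(y,x)$ for all $x,y$, and let $F(G)=\sum_{uv\in E(G)}f(d(u),d(v))$. Let $a,b\in \{\delta,\ldots,\Delta\}$ with $a\leq b$ be chosen to minimise $\frac{ab\,f(a,b)}{a+b}$. Then any graph $G$ with minimum degree at least $\delta$ and maximum degree at most $\Delta$ satisfies $F(G)\geq \frac{ab\,f(a,b)}{a+b}|G|$. Equality occurs if $G$ is $(a,b)$-biregular, and, provided the choice of the pair $(a,b)$ is unique, this is the only case in which equality occurs.
   Context: Graphs are finite and simple; $|G|$ denotes the number of vertices of $G$ and $d(u)$ the degree of a vertex $u$. For integers $r,s\geq 1$, a graph is $(r,s)$-biregular if every vertex has degree either $r$ or $s$ and every edge has one endpoint of each of these degrees ($(r,r)$-biregular means $r$-regular). *)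

(* Defs.v *)
From HB Require Import structures.
From mathcomp Require Import all_boot all_order all_algebra.
From mathcomp Require Import reals.

Set Implicit Arguments.
Unset Strict Implicit.
Unset Printing Implicit Defensive.

Import Order.TTheory GRing.Theory Num.Theory.
Local Open Scope ring_scope.

(* A finite simple graph is a symmetric irreflexive adjacency relation on a
   finType of vertices; edges are the two-element sets of adjacent vertices. *)

Definition simple_graph (T : finType) (e : rel T) : Prop :=
  symmetric e /\ irreflexive e.

Definition deg (T : finType) (e : rel T) (u : T) : nat := #|[set v | e u v]|.

Definition edges (T : finType) (e : rel T) : {set {set T}} :=
  [set [set p.1; p.2] | p : T * T & e p.1 p.2].

(* The two endpoints of A are listed in the enumeration order of T. Endpoints of
   an edge have positive degree, so when f is symmetric on positive integers the
   weight of an edge does not depend on this order. The default 0 is never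
   reached on the edges of a simple graph. *)
Definition edge_weight (R : realType) (T : finType) (e : rel T)
    (f : nat -> nat -> R) (A : {set T}) : R :=
  if enum A is [:: u; v] then f (deg e u) (deg e v) else 0.

Definition F (R : realType) (T : finType) (e : rel T) (f : nat -> nat -> R) : R :=
  \sum_(A in edges e) edge_weight e f A.

Definition biregular (T : finType) (e : rel T) (r s : nat) : Prop :=
  (forall u, deg e u = r \/ deg e u = s) /\
  (forall u v, e u v ->
     (deg e u = r /\ deg e v = s) \/ (deg e u = s /\ deg e v = r)).

Definition ratio (R : realType) (f : nat -> nat -> R) (x y : nat) : R :=
  x%:R * y%:R * f x y / (x%:R + y%:R).

Definition admissible (delta Delta x y : nat) : bool :=
  [&& (delta <= x)%N, (x <= y)%N & (y <= Delta)%N].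

Definition minimises (R : realType) (f : nat -> nat -> R)
    (delta Delta a b : nat) : Prop :=
  admissible delta Delta a b /\
  (forall x y, admissible delta Delta x y -> ratio f a b <= ratio f x y).

(* Main.v *)
(** Summing 1/d(u) over the ordered pairs of adjacent vertices gives |G|, so
    2 F(G) - 2 r |G| is the sum over ordered adjacent pairs (u, v) of
    f(d(u), d(v)) - r (1/d(u) + 1/d(v)).  For r the minimal value of
    x y f(x, y) / (x + y), every term is nonnegative, and it vanishes exactly
    when the pair of degrees of u and v attains the minimum. *)
Require Import Defs.
From HB Require Import structures.
From mathcomp Require Import all_boot all_order all_algebra.
From mathcomp Require Import reals ring.

Set Implicit Arguments.
Unset Strict Implicit.
Unset Printing Implicit Defensive.

Import Order.TTheory GRing.Theory Num.Theory.
Local Open Scope ring_scope.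

(** [edge_weight] reads the endpoints off the enumeration of the edge, whose order is not known in
    advance. *)
Lemma enum_set2 (T : finType) (u v : T) : u != v ->
  enum [set u; v] = [:: u; v] \/ enum [set u; v] = [:: v; u].
Proof.
move=> uv.
have sz : size (enum [set u; v]) = 2 by rewrite -cardE cards2 uv.
have mem z : (z \in enum [set u; v]) = (z == u) || (z == v).
  by rewrite mem_enum !inE.
have := enum_uniq [set u; v]; move: sz mem.
case: (enum _) => [|x [|y [|? ?]]] //= _ mem; rewrite inE andbT => xy.
have /orP[] := etrans (esym (mem x)) (mem_head x _) => /eqP xE.
  have : v \in [:: x; y] by rewrite mem eqxx orbT.
  by rewrite !inE xE eq_sym (negPf uv) => /eqP ->; left.
have : u \in [:: x; y] by rewrite mem eqxx.
by rewrite !inE xE (negPf uv) => /eqP ->; right.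
Qed.

(** Describes the fibre over an edge of the map from ordered pairs to two-element sets, as needed
    for double counting. *)
Lemma eq_set2 (T : finType) (x y u v : T) : x != y ->
  ([set x; y] == [set u; v]) = ((x, y) == (u, v)) || ((x, y) == (v, u)).
Proof.
move=> xy; apply/eqP/orP => [E|[]/eqP[-> ->] //]; last by rewrite setUC.
have : x \in [set u; v] by rewrite -E set21.
have : y \in [set u; v] by rewrite -E set22.
rewrite !inE => /orP[]/eqP yE /orP[]/eqP xE; move: xy; rewrite xE yE ?eqxx //.
- by right.
- by left.
Qed.

Section SimpleGraph.
Variables (R : realType) (T : finType) (e : rel T).
Hypothesis he : simple_graph e.

Lemma adj_neq u v : e u v -> u != v.
Proof. by move=> euv; apply: contraTneq euv => ->; rewrite he.2. Qed.

Lemma deg_gt0 u v : e u v -> (0 < deg e u)%N.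
Proof. by move=> euv; apply/card_gt0P; exists v; rewrite inE. Qed.

(** Each edge comes from exactly two ordered pairs, on which [f] takes the same value: both
    endpoints have positive degree, so [fsym] applies. *)
Lemma double_F (f : nat -> nat -> R) :
  (forall x y, (0 < x)%N -> (0 < y)%N -> f x y = f y x) ->
  F e f *+ 2 = \sum_(p : T * T | e p.1 p.2) f (deg e p.1) (deg e p.2).
Proof.
move=> fsym; have [eC _] := he.
rewrite (partition_big (fun p : T * T => [set p.1; p.2]) (mem (edges e))) /=;
  last by move=> p ep; apply/imsetP; exists p; rewrite ?inE.
rewrite /F -sumrMnl; apply: eq_bigr => A /imsetP[[u v]].
rewrite inE /= => euv ->; have uv := adj_neq euv.
have fE : f (deg e v) (deg e u) = f (deg e u) (deg e v).
  by apply: fsym; [apply: (@deg_gt0 v u); rewrite eC | apply: deg_gt0 euv].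
have -> : edge_weight e f [set u; v] = f (deg e u) (deg e v).
  by rewrite /edge_weight; case: (enum_set2 uv) => ->.
rewrite (eq_bigl (mem [set (u, v); (v, u)])); last first.
  move=> [x y]; rewrite /= !inE /=; case exy: (e x y) => /=.
    by rewrite eq_set2 ?adj_neq.
  by apply/esym/negbTE; apply: contraFN exy => /orP[]/eqP[-> ->]; rewrite // eC.
rewrite big_setU1 ?big_set1 /= ?fE ?mulr2n // inE.
by rewrite xpair_eqE (negPf uv).
Qed.

(** Grouped by first coordinate, a vertex of degree d > 0 contributes d terms 1/d, hence 1; an
    isolated vertex would contribute 0. *)
Lemma card_sum_inv_deg : (forall u, 0 < deg e u)%N ->
  #|T|%:R = \sum_(p : T * T | e p.1 p.2) (deg e p.1)%:R^-1 :> R.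
Proof.
move=> d0; rewrite -(pair_big_dep xpredT e (fun u _ => (deg e u)%:R^-1)) /=.
rewrite -sum1_card natr_sum; apply: eq_bigr => u _.
rewrite sumr_const -[RHS]mulr_natr.
have -> : #|e u| = deg e u by rewrite /deg cardsE.
by rewrite mulVf // pnatr_eq0 -lt0n d0.
Qed.

Lemma card_sum_inv_deg_sym : (forall u, 0 < deg e u)%N ->
  #|T|%:R *+ 2 = \sum_(p : T * T | e p.1 p.2)
    ((deg e p.1)%:R^-1 + (deg e p.2)%:R^-1) :> R.
Proof.
move=> d0; rewrite big_split mulr2n /= -card_sum_inv_deg //; congr (_ + _).
rewrite card_sum_inv_deg // (reindex_inj (h := fun p => (p.2, p.1))) /=.
  by apply: eq_bigl => p; rewrite he.1.
by move=> [x y] [z w] [-> ->].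
Qed.

(** For positive x and y, 1/x + 1/y = (x + y)/(xy), so f(x, y) is the ratio at (x, y) times 1/x +
    1/y; this factor is then common to both sums. *)
Lemma double_excess (f : nat -> nat -> R) (r : R) :
  (forall x y, (0 < x)%N -> (0 < y)%N -> f x y = f y x) ->
  (forall u, 0 < deg e u)%N ->
  (F e f - r * #|T|%:R) *+ 2 = \sum_(p : T * T | e p.1 p.2)
    (Defs.ratio f (deg e p.1) (deg e p.2) - r)
    * ((deg e p.1)%:R^-1 + (deg e p.2)%:R^-1).
Proof.
move=> fsym d0; rewrite mulrnBl double_F // -mulrnAr card_sum_inv_deg_sym //.
rewrite mulr_sumr -sumrB; apply: eq_bigr => p _; rewrite mulrBl; congr (_ - _).
have x0 : (deg e p.1)%:R != 0 :> R by rewrite pnatr_eq0 -lt0n.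
have y0 : (deg e p.2)%:R != 0 :> R by rewrite pnatr_eq0 -lt0n.
have xy0 : (deg e p.1)%:R + (deg e p.2)%:R != 0 :> R.
  by rewrite -natrD pnatr_eq0 addn_eq0 negb_and -!lt0n d0.
by rewrite /Defs.ratio; field; rewrite x0 y0 xy0.
Qed.

End SimpleGraph.

Lemma ratioC (R : realType) (f : nat -> nat -> R) (x y : nat) :
  f x y = f y x -> Defs.ratio f x y = Defs.ratio f y x.
Proof. by rewrite /Defs.ratio => ->; rewrite (mulrC x%:R) (addrC x%:R). Qed.

Theorem theorem1 (R : realType) (delta Delta : nat) (f : nat -> nat -> R)
    (a b : nat)
    (hdelta : (1 <= delta)%N) (hDelta : (delta <= Delta)%N)
    (fsym : forall x y : nat, (0 < x)%N -> (0 < y)%N -> f x y = f y x)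
    (hab : minimises f delta Delta a b)
    (T : finType) (e : rel T) (he : simple_graph e)
    (hmin : forall u : T, (delta <= deg e u)%N)
    (hmax : forall u : T, (deg e u <= Delta)%N) :
  [/\ F e f >= a%:R * b%:R * f a b / (a%:R + b%:R) * #|T|%:R,
      biregular e a b ->
        F e f = a%:R * b%:R * f a b / (a%:R + b%:R) * #|T|%:R
    & (forall x y : nat, minimises f delta Delta x y -> x = a /\ y = b) ->
        F e f = a%:R * b%:R * f a b / (a%:R + b%:R) * #|T|%:R ->
        biregular e a b].
Proof.
rewrite -/(Defs.ratio f a b); have [_ abmin] := hab.
have d0 u : (0 < deg e u)%N by apply: leq_trans (hmin u).
have rC u v :
    Defs.ratio f (deg e u) (deg e v) = Defs.ratio f (deg e v) (deg e u).
  by apply/ratioC/fsym.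
(* Admissible pairs are ordered, so the two degrees are swapped when necessary. *)
have rmin u v : Defs.ratio f a b <= Defs.ratio f (deg e u) (deg e v).
  case/orP: (leq_total (deg e u) (deg e v)) => uv; last rewrite rC.
    by apply: abmin; rewrite /admissible hmin hmax uv.
  by apply: abmin; rewrite /admissible hmin hmax uv.
have inv0 u v : 0 < (deg e u)%:R^-1 + (deg e v)%:R^-1 :> R.
  by rewrite addr_gt0 // invr_gt0 ltr0n.
have excess := double_excess he (Defs.ratio f a b) fsym d0.
have term0 (p : T * T) : e p.1 p.2 ->
    0 <= (Defs.ratio f (deg e p.1) (deg e p.2) - Defs.ratio f a b)
      * ((deg e p.1)%:R^-1 + (deg e p.2)%:R^-1).
  by move=> _; rewrite mulr_ge0 ?subr_ge0 ?rmin // ltW.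
split.
- by rewrite -subr_ge0 -(@pmulrn_lge0 _ _ 2) // excess sumr_ge0.
- move=> [_ ebi]; apply/eqP; rewrite -subr_eq0.
  suff: (F e f - Defs.ratio f a b * #|T|%:R) *+ 2 == 0 by rewrite mulrn_eq0.
  rewrite excess big1 // => p /ebi; case=> -[E1 E2].
    by rewrite E1 E2 subrr mul0r.
  by rewrite rC E1 E2 subrr mul0r.
- move=> uniq FE.
  have ab u v : e u v ->
      deg e u = a /\ deg e v = b \/ deg e u = b /\ deg e v = a.
    (* A zero sum of nonnegative terms has only zero terms; since the factor 1/d(u) + 1/d(v) is
       positive, the ratio at the degrees of [u] and [v] must be the minimum. *)
    move=> euv; move/esym/eqP: excess; rewrite FE subrr mul0rn psumr_eq0 //.
    move=> /allP/(_ (u, v) (mem_index_enum _))/implyP/(_ euv) /=.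
    rewrite mulf_eq0 (gt_eqF (inv0 _ _)) orbF subr_eq0 => /eqP rE.
    (* Uniqueness concerns ordered pairs, so the order of the degrees decides which endpoint has
       degree [a]. *)
    case/orP: (leq_total (deg e u) (deg e v)) => uv; [left|right].
      by apply: uniq; split; [rewrite /admissible hmin hmax uv | rewrite rE].
    apply/and_comm/uniq; split; first by rewrite /admissible hmin hmax uv.
    by rewrite rC rE.
  (* Every vertex has a neighbour, so the condition on edges determines its degree. *)
  split=> // u; have /card_gt0P[v] := d0 u.
  by rewrite inE => /ab[][-> _]; [left|right].
Qed.
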